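(* Let $X$ be a finite asymmetric graph, let $S$ be a unique-neighbourhood clique in $X$, and suppose that for some $v\in S$ the set $S\cap[v]$ has odd cardinality. If $\langle N(v,X)\rangle$ or $\langle\bigcap_{w\in S}N(w,X)\rangle$ does not have an automorphism that is a product of transpositions, then $X$ is not the induced neighbourhood of a finite vertex-transitive graph (i.e. there is no finite vertex-transitive graph $Y$ with $\langle N(y,Y)\rangle\cong X$ for its vertices $y$).
   Context: All graphs are simple. $N(v,X)$ is the set of neighbours of $v$ in $X$, and $\langle A\rangle$ is the subgraph induced on $A$. A graph is asymmetric if its only automorphism is the identity. $[v]=\{w\in V(X):\langle N(w,X)\rangle\cong\langle N(v,X)\rangle\}$. A clique $S$ of $X$ is a unique-neighbourhood clique if for every clique $S'\neq S$ of $X$ with $|S'|=|S|$, $\langle\bigcap_{w\in S'}N(w,X)\rangle\not\cong\langle\bigcap_{w\in S}N(w,X)\rangle$. An automorphism of a graph is called a product of transpositions if, as a permutation of the vertex set, it is a product of disjoint transpositions moving every vertex (a fixed-point-free involution; for the graph with no vertices, the identity). *)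

(* Defs.v *)
From mathcomp Require Import all_boot all_fingroup.

Set Implicit Arguments.
Unset Strict Implicit.
Unset Printing Implicit Defensive.

Record sgraph := SGraph {
  vertex :> finType;
  adj : rel vertex;
  adj_sym : symmetric adj;
  adj_irr : irreflexive adj
}.

Definition nbhd (X : sgraph) (v : X) : {set X} := [set w | adj v w].

Section Induced.
Variables (X : sgraph) (A : {set X}).

Definition induced_adj : rel {x : X | x \in A} :=
  fun x y => adj (val x) (val y).

Lemma induced_adj_sym : symmetric induced_adj.
Proof. by move=> x y; apply: adj_sym. Qed.

Lemma induced_adj_irr : irreflexive induced_adj.
Proof. by move=> x; apply: adj_irr. Qed.

Definition induced : sgraph := SGraph induced_adj_sym induced_adj_irr.
End Induced.

Definition iso (G H : sgraph) : Prop :=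
  exists f : G -> H, bijective f /\ forall x y, adj (f x) (f y) = adj x y.

(* Boolean version of [iso], needed to form the finite set [nbhd_class v]. *)
Definition isob (G H : sgraph) : bool :=
  [exists f : {ffun G -> H},
    [&& injectiveb f, [forall y, y \in codom f] &
        [forall x, forall y, adj (f x) (f y) == adj x y]]].

Lemma isoP (G H : sgraph) : reflect (iso G H) (isob G H).
Proof.
apply: (iffP existsP) => [[f /and3P[/injectiveP injf /forallP surjf]]|].
  move=> /forallP adjf; exists f; split=> [|x y]; last first.
    by apply/eqP; move/forallP: (adjf x).
  exists (fun y => iinv (surjf y)) => [x|y]; last exact: f_iinv.
  by apply: injf; rewrite f_iinv.
case=> f [bijf adjf]; exists [ffun x => f x]; apply/and3P; split.
- by apply/injectiveP => x y; rewrite !ffunE; apply: (bij_inj bijf).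
- apply/forallP => y; case: bijf => g _ gK.
  by apply/codomP; exists (g y); rewrite ffunE gK.
- by apply/forallP => x; apply/forallP => y; rewrite !ffunE adjf.
Qed.

Definition is_aut (G : sgraph) (f : {perm G}) : Prop :=
  forall x y, adj (f x) (f y) = adj x y.

Definition asymmetric_graph (G : sgraph) : Prop :=
  forall f : {perm G}, is_aut f -> f = 1%g.

Definition vertex_transitive (G : sgraph) : Prop :=
  forall x y : G, exists f : {perm G}, is_aut f /\ f x = y.

Definition nbhd_class (X : sgraph) (v : X) : {set X} :=
  [set w | isob (induced (nbhd w)) (induced (nbhd v))].

Definition clique (X : sgraph) (S : {set X}) : Prop :=
  {in S &, forall x y, x != y -> adj x y}.

Definition common_nbhd (X : sgraph) (S : {set X}) : {set X} :=
  \bigcap_(w in S) nbhd w.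

Definition unique_nbhd_clique (X : sgraph) (S : {set X}) : Prop :=
  clique S /\
  forall S' : {set X}, clique S' -> S' <> S -> #|S'| = #|S| ->
    ~ iso (induced (common_nbhd S')) (induced (common_nbhd S)).

(* A product of disjoint transpositions moving every point is the same thing
   as a fixed-point-free involution; on the empty type the identity
   qualifies. *)
Definition prod_of_transpositions (T : finType) (f : {perm T}) : Prop :=
  involutive f /\ forall x, f x != x.

Definition has_transposition_aut (G : sgraph) : Prop :=
  exists f : {perm G}, is_aut f /\ prod_of_transpositions f.

(* A graph without vertices has no vertex neighbourhood, so [Y] is required to
   be nonempty. *)
Definition is_induced_nbhd_of (X Y : sgraph) : Prop :=
  0 < #|Y| /\ forall y : Y, iso (induced (nbhd y)) X.

(* Main.v *)
Require Import Defs.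
From mathcomp Require Import all_boot all_fingroup.

(** Suppose [Y] is vertex-transitive with all neighbourhoods isomorphic to the
    asymmetric graph [X].  Then each neighbourhood [N(y)] is identified with [X]
    by a unique isomorphism [phi y], so every arc [(y, z)] of [Y] carries a
    label in [X], and automorphisms of [Y] preserve labels.  By transitivity the
    label of the reversed arc depends only on the label of the arc, which gives
    an involution [sigma] of [X]; it preserves each class [[x]] because both
    labels of an edge [yz] have neighbourhood isomorphic to [N(y) :&: N(z)].
    Since [S] is a unique-neighbourhood clique, the cliques [y |: phi y @: S] of
    [Y] coincide as soon as they share a vertex, so [sigma] preserves [S] as
    well.  Parity then gives a fixed point [s] of [sigma] in [S :&: [v]]: an
    automorphism of [Y] moving [y] to [phi y s] swaps the two.  Automorphisms
    fixing a vertex fix its neighbourhood pointwise, so the swap acts as a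
    fixed-point-free involution on all common neighbours of [y] and [phi y s]. *)

Set Implicit Arguments.
Unset Strict Implicit.
Unset Printing Implicit Defensive.

(** Deleting a two-point orbit [{x, f x}] keeps stability under [f] and the parity of the size. *)
Lemma involution_fixpoint (T : finType) (f : T -> T) (A : {set T}) :
  involutive f -> {in A, forall x, f x \in A} -> odd #|A| ->
  exists2 x, x \in A & f x = x.
Proof.
move=> fK; elim: {A}_.+1 {-2}A (ltnSn #|A|) => // n IHn A leAn fA oddA.
have [A0 | [x xA]] := set_0Vmem A; first by rewrite A0 cards0 in oddA.
have [fx | fx] := eqVneq (f x) x; first by exists x.
pose B := A :\ x :\ f x.
have fxB : f x \in A :\ x by rewrite !inE fx fA.
have cardA : #|A| = #|B|.+2.
  by rewrite (cardsD1 x) xA (cardsD1 (f x) (A :\ x)) fxB.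
have [||| y yB fy] := IHn B.
- by rewrite cardA in leAn; apply: ltnW.
- move=> y; rewrite !inE (inj_eq (can_inj fK)) => /and3P[yfx yx yA].
  by rewrite yx fA //= andbT; apply: contra yfx => /eqP <-; rewrite fK.
- by rewrite cardA /= negbK in oddA.
by exists y => //; move: yB; rewrite !inE => /and3P[].
Qed.

Lemma iso_sym (G H : sgraph) : iso G H -> iso H G.
Proof.
case=> f [[g fK gK] adjf]; exists g; split=> [|x y]; first by exists f.
by rewrite -adjf !gK.
Qed.

Lemma iso_trans (G H K : sgraph) : iso G H -> iso H K -> iso G K.
Proof.
case=> f [bijf adjf] [g [bijg adjg]]; exists (g \o f); split=> [|x y] /=.
  exact: bij_comp.
by rewrite adjg adjf.
Qed.

Lemma has_transposition_aut_iso (G H : sgraph) :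
  iso G H -> has_transposition_aut G -> has_transposition_aut H.
Proof.
case=> f [[g fK gK] adjf] [t [autt [tK t_free]]].
have hK : involutive (fun x => f (t (g x))) by move=> x; rewrite fK tK gK.
exists (perm (can_inj hK)); split=> [x y|]; last split=> x.
- by rewrite !permE adjf autt -adjf !gK.
- by rewrite !permE hK.
- by rewrite permE -(can_eq gK) fK t_free.
Qed.

Lemma iso_induced_imset (X Y : sgraph) (f : X -> Y) (A : {set X}) :
  injective f -> (forall x y, adj (f x) (f y) = adj x y) ->
  iso (induced A) (induced (f @: A)).
Proof.
move=> injf adjf.
pose h (u : induced A) : induced (f @: A) :=
  exist _ (f (val u)) (imset_f f (valP u)).
have injh : injective h by move=> u w [/injf]; apply: val_inj.
exists h; split; last by move=> u w; apply: adjf.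
by apply: inj_card_bij => //; rewrite !card_sig card_imset.
Qed.

Lemma in_common_nbhd (X : sgraph) (S : {set X}) (x : X) :
  reflect {in S, forall w, adj w x} (x \in common_nbhd S).
Proof.
by apply: (iffP bigcapP) => H w wS; move: (H w wS); rewrite inE.
Qed.

Lemma common_nbhd_aut (Y : sgraph) (g : {perm Y}) (T : {set Y}) (x : Y) :
  is_aut g -> g @: T = T -> x \in common_nbhd T -> g x \in common_nbhd T.
Proof.
move=> autg gT /in_common_nbhd Tx; apply/in_common_nbhd => w.
by rewrite -{1}gT => /imsetP[u uT ->]; rewrite autg Tx.
Qed.

Section NeighbourhoodLabelling.
Variables (X Y : sgraph) (phi : Y -> X -> Y).

(** An isomorphism of [X] onto the subgraph induced on the neighbourhood of [y], taken as a map into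
    [Y] so that it composes directly with automorphisms. *)
Definition nbhd_embedding (y : Y) (f : X -> Y) : Prop :=
  [/\ injective f, forall a b, adj (f a) (f b) = adj a b
    & forall z, adj y z = (z \in codom f)].

Hypothesis X_asym : asymmetric_graph X.

(** Following [f] by the inverse of [g] gives an automorphism of [X]. *)
Lemma nbhd_embedding_uniq (y : Y) (f g : X -> Y) :
  nbhd_embedding y f -> nbhd_embedding y g -> f =1 g.
Proof.
move=> [injf adjf imf] [injg adjg img].
have fg x : f x \in codom g by rewrite -img imf codom_f.
have injh : injective (fun x => iinv (fg x)).
  by move=> a b /(congr1 g); rewrite !f_iinv => /injf.
have/X_asym h1 : is_aut (perm injh).
  by move=> a b; rewrite !permE -adjg !f_iinv adjf.
by move=> x; rewrite -(f_iinv (fg x)) -[iinv _](permE injh) h1 perm1.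
Qed.

Hypothesis phiP : forall y, nbhd_embedding y (phi y).

Lemma phi_inj (y : Y) : injective (phi y).
Proof. by case: (phiP y). Qed.

Lemma phi_adj (y : Y) (a b : X) : adj (phi y a) (phi y b) = adj a b.
Proof. by case: (phiP y) => _ ->. Qed.

Lemma adj_phi (y : Y) (x : X) : adj y (phi y x).
Proof. by case: (phiP y) => _ _ ->; apply: codom_f. Qed.

Lemma phi_surj (y z : Y) : adj y z -> exists x, z = phi y x.
Proof. by case: (phiP y) => _ _ -> /codomP. Qed.

Lemma phi_neq (y : Y) (x : X) : phi y x != y.
Proof. by apply/eqP => E; move: (adj_phi y x); rewrite E adj_irr. Qed.

(** As functions of [x], both sides embed [X] onto the neighbourhood of [g y]. *)
Lemma aut_phi (g : {perm Y}) (y : Y) (x : X) :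
  is_aut g -> g (phi y x) = phi (g y) x.
Proof.
move=> autg; apply: (@nbhd_embedding_uniq (g y) (g \o phi y)) => //.
case: (phiP y) => injf adjf imf; split=> [a b /= /perm_inj/injf // | a b /= | z].
  by rewrite autg adjf.
rewrite -(permKV g z) autg imf.
apply/codomP/codomP => -[x0 Ez]; exists x0; first by rewrite /= Ez.
exact: perm_inj Ez.
Qed.

Lemma aut_fix_nbhd (g : {perm Y}) (y z : Y) :
  is_aut g -> g y = y -> adj y z -> g z = z.
Proof. by move=> autg gy /phi_surj[x ->]; rewrite aut_phi // gy. Qed.

Lemma swap_common_nbhd (g : {perm Y}) (y z : Y) (T : {set Y}) :
  is_aut g -> g y = z -> g z = y -> y != z -> y \in T -> g @: T = T ->
  has_transposition_aut (induced (common_nbhd T)).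
Proof.
move=> autg gy gz neq_yz yT gT.
pose h (u : induced (common_nbhd T)) : induced (common_nbhd T) :=
  exist _ (g (val u)) (common_nbhd_aut autg gT (valP u)).
have hK : involutive h.
  case=> u uC; apply: val_inj => /=.
  (* The square of [g] fixes [y], hence its neighbours, and [u] is one since [y] is in [T]. *)
  rewrite -permM; apply: (@aut_fix_nbhd _ y) => [a b||].
  - by rewrite !permM !autg.
  - by rewrite permM gy.
  - by move/in_common_nbhd: uC; apply.
exists (perm (can_inj hK)); split=> [a b|]; last split=> u.
- by rewrite !permE; exact: (autg (val a) (val b)).
- by rewrite !permE hK.
rewrite permE; apply: contra neq_yz => /eqP/(congr1 val) /= gu.
(* If [g] fixed [u], it would fix the neighbour [y] of [u]. *)
rewrite -gy eq_sym; apply/eqP; apply: (aut_fix_nbhd autg gu).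
by rewrite adj_sym; move/in_common_nbhd: (valP u); apply.
Qed.

Definition star (y : Y) (S : {set X}) : {set Y} := y |: phi y @: S.

Lemma card_star (y : Y) (S : {set X}) : #|star y S| = #|S|.+1.
Proof.
rewrite cardsU1 card_imset; last exact: phi_inj.
suff -> : y \notin phi y @: S by [].
by apply/imsetP => -[x _ E]; move: (phi_neq y x); rewrite -E eqxx.
Qed.

Lemma aut_star (g : {perm Y}) (y : Y) (S : {set X}) :
  is_aut g -> g @: star y S = star (g y) S.
Proof.
move=> autg; rewrite /star imsetU1 -imset_comp; congr (_ |: _).
by apply: eq_imset => x /=; rewrite aut_phi.
Qed.

Lemma clique_star (y : Y) (S : {set X}) : clique S -> clique (star y S).
Proof.
move=> cS a b /setU1P[->|/imsetP[s sS ->]] /setU1P[->|/imsetP[t tS ->]].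
- by rewrite eqxx.
- by rewrite adj_phi.
- by rewrite adj_sym adj_phi.
- by rewrite phi_adj (inj_eq (@phi_inj y)); apply: cS.
Qed.

(** A common neighbour of the star is adjacent to [y], so it is the image under [phi y] of some
    vertex of [X]. *)
Lemma iso_common_nbhd_star (y : Y) (S : {set X}) :
  iso (induced (common_nbhd S)) (induced (common_nbhd (star y S))).
Proof.
suff -> : common_nbhd (star y S) = phi y @: common_nbhd S.
  by apply: iso_induced_imset; [apply: phi_inj | apply: phi_adj].
apply/setP => z; apply/in_common_nbhd/imsetP => [zK | [x /in_common_nbhd xS ->]].
  have /phi_surj[x Ez] := zK y (setU11 _ _); exists x => //.
  apply/in_common_nbhd => s sS.
  by rewrite -(phi_adj y) -Ez zK // setU1r // imset_f.
move=> w /setU1P[->|/imsetP[s sS ->]]; first exact: adj_phi.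
by rewrite phi_adj xS.
Qed.

(** For a singleton the star is an edge, whose common neighbourhood does not depend on which end is
    called [y]. *)
Lemma iso_nbhd_star1 (y : Y) (x : X) :
  iso (induced (nbhd x)) (induced (common_nbhd (star y [set x]))).
Proof.
have -> : nbhd x = common_nbhd [set x] by rewrite /common_nbhd big_set1.
exact: iso_common_nbhd_star.
Qed.

(** Read from [z], the same clique has a label set [S'] of the size of [S] with isomorphic common
    neighbourhood, so [S' = S]. *)
Lemma star_eq (S : {set X}) (y z : Y) :
  unique_nbhd_clique S -> z \in star y S -> star z S = star y S.
Proof.
move=> [cS uS] zK; pose S' := phi z @^-1: star y S.
have inS' x : (x \in S') = (phi z x \in star y S) by rewrite inE.
have cK := @clique_star y S cS.
have EK : star z S' = star y S.
  apply/setP => w; apply/setU1P/idP => [[-> //|/imsetP[x xS' ->]]|wK].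
    by rewrite -inS'.
  have [|neq_wz] := eqVneq w z; first by left.
  right; have /phi_surj[x Ew] : adj z w by apply: cK; rewrite // eq_sym.
  by rewrite Ew imset_f // inS' -Ew.
have [ES | /eqP neqS] := eqVneq S' S; first by rewrite -[in LHS]ES.
exfalso; apply: (uS S') => //.
- move=> a b aS' bS' neq_ab; rewrite -(phi_adj z).
  by apply: cK; rewrite ?(inj_eq (@phi_inj z)) // -inS'.
- by apply/succn_inj; rewrite -(card_star z) EK card_star.
apply: iso_trans (iso_common_nbhd_star z S') _; rewrite EK.
exact: iso_sym (iso_common_nbhd_star y S).
Qed.

(** The reverse label is chosen at one vertex [y0]; automorphisms carry it to every [y]. *)
Lemma reverse_label :
  0 < #|Y| -> vertex_transitive Y ->
  exists2 sigma : X -> X, involutive sigma &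
    forall y x, phi (phi y x) (sigma x) = y.
Proof.
move=> /card_gt0P[y0 _] Ytr.
have ex_rev x : exists t, phi (phi y0 x) t == y0.
  have [|t Et] := @phi_surj (phi y0 x) y0; first by rewrite adj_sym adj_phi.
  by exists t; rewrite -Et.
pose sigma x := xchoose (ex_rev x).
have sigmaP y x : phi (phi y x) (sigma x) = y.
  have [g [autg <-]] := Ytr y0 y.
  by rewrite -!aut_phi // (eqP (xchooseP (ex_rev x))).
exists sigma => // x; apply: (@phi_inj y0).
(* Reversing the arc from [phi y0 x] to [y0] leads back to [phi y0 x]. *)
by rewrite -{1}(sigmaP y0 x) sigmaP.
Qed.

End NeighbourhoodLabelling.

Lemma ex_nbhd_embedding (X Y : sgraph) (y : Y) :
  iso (induced (nbhd y)) X -> exists f : {ffun X -> Y}, nbhd_embedding y f.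
Proof.
move=> /iso_sym[f [[g fK gK] adjf]]; exists [ffun x => val (f x)].
split=> [a b | a b | z]; rewrite ?ffunE.
- by move/val_inj/(can_inj fK).
- exact: adjf.
apply/idP/codomP => [yz | [x ->]]; last first.
  by rewrite ffunE; have := valP (f x); rewrite inE.
have zN : z \in nbhd y by rewrite inE.
by exists (g (exist _ z zN)); rewrite ffunE gK.
Qed.

Theorem theorem2p7 (X : sgraph) (S : {set X}) (v : X)
    (X_asym : asymmetric_graph X)
    (S_unique : unique_nbhd_clique S)
    (v_in_S : v \in S)
    (S_odd : odd #|S :&: nbhd_class v|)
    (no_aut : ~ has_transposition_aut (induced (nbhd v)) \/
              ~ has_transposition_aut (induced (common_nbhd S))) :
  ~ exists Y : sgraph, vertex_transitive Y /\ is_induced_nbhd_of X Y.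
Proof.
move=> [Y [Ytr [Y_gt0 isoY]]].
have /fin_all_exists[phi phiP] := fun y => ex_nbhd_embedding (isoY y).
have [sigma sigmaK sigmaP] := reverse_label X_asym phiP Y_gt0 Ytr.
have /card_gt0P[y _] := Y_gt0.
have sigma_iso x : iso (induced (nbhd (sigma x))) (induced (nbhd x)).
  apply: iso_trans (iso_nbhd_star1 phiP (phi y x) (sigma x)) _.
  rewrite /star imset_set1 sigmaP setUC -imset_set1.
  exact: iso_sym (iso_nbhd_star1 phiP y x).
have sigmaS x : x \in S -> sigma x \in S.
  move=> xS; have zK : phi y x \in star phi y S by rewrite setU1r // imset_f.
  (* Seen from [phi y x], the vertex [y] has a label in [S]; by injectivity it is [sigma x]. *)
  have /setU1P[E|/imsetP[t tS E]] : y \in star phi (phi y x) S.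
  - by rewrite (star_eq phiP S_unique zK) setU11.
  - by have := phi_neq phiP y x; rewrite -E eqxx.
  - suff -> : sigma x = t by [].
    by apply: (phi_inj phiP (y := phi y x)); rewrite sigmaP.
have [x /setIP[xS xv] | s] := involution_fixpoint sigmaK _ S_odd.
  move: xv; rewrite !in_set sigmaS //= => /isoP iso_xv.
  exact/isoP/(iso_trans (sigma_iso x)).
move=> /setIP[sS /[!inE]/isoP iso_sv] fix_s.
have [g [autg gy]] := Ytr y (phi y s).
(* Since [sigma s = s], the arc from [phi y s] back to [y] also has label [s]. *)
have gz : g (phi y s) = y.
  by rewrite (aut_phi X_asym phiP) // gy -{2}fix_s sigmaP.
have neq_yz : y != phi y s by rewrite eq_sym (phi_neq phiP).
have swap := swap_common_nbhd X_asym phiP autg gy gz neq_yz.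
case: no_aut; apply.
  (* Here [T] is the edge joining [y] and [phi y s], whose ends [g] exchanges. *)
  apply: has_transposition_aut_iso iso_sv _.
  apply: has_transposition_aut_iso (iso_sym (iso_nbhd_star1 phiP y s)) _.
  apply: swap; first by rewrite setU11.
  by rewrite /star imsetU1 !imset_set1 gy gz setUC.
(* Here [T] is the star of [y], which equals that of [g y] by [star_eq]. *)
apply: has_transposition_aut_iso (iso_sym (iso_common_nbhd_star phiP y S)) _.
apply: swap; first by rewrite setU11.
rewrite (aut_star X_asym phiP) // gy.
by apply: (star_eq phiP S_unique); rewrite setU1r // imset_f.
Qed.
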